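(* Let $\mathcal B=(X,Y,Z)$ be a bilinear triple of Banach spaces, let $f\in(\mathcal B)G([a,b],X)$ (i.e. $f:[a,b]\to X$ is simply-regulated) and let $g:[a,b]\to Y$. Let $T$ be a closed subset of $[a,b]$ and suppose $$S:=[a,b]\setminus T=\bigcup_{i\in\mathbb N}E_i,$$ where $E_i$, $i\in\mathbb N$, are mutually disjoint elementary sets in $[a,b]$. Put $S_n=\bigcup_{i=1}^nE_i$ for $n\in\mathbb N$. Assume that the integral $\int_{[a,b]}[\mathrm df]\,g$ exists and that the sequence $\{g\chi_{S_n}\}_{n\in\mathbb N}$ is equi-integrable with respect to $f$ on $[a,b]$. Then: (i) All the integrals $\int_{E_i}[\mathrm df]\,g$ for $i\in\mathbb N$, $\int_S[\mathrm df]\,g$ and $\int_T[\mathrm df]\,g$ exist, and $$\int_S[\mathrm df]\,g=\sum_{i=1}^\infty\int_{E_i}[\mathrm df]\,g\qquad\text{and}\qquad\int_{[a,b]}[\mathrm df]\,g=\int_T[\mathrm df]\,g+\int_S[\mathrm df]\,g .$$ (ii) For every $\varepsilon>0$ there is a gauge $\delta$ on $T$ such that $$\Big\|\sum_{j=1}^{\nu(Q)}\Big(\int_{\alpha_j}^{\beta_j}[\mathrm df]\,(g\chi_T)-\int_{\alpha_j}^{\beta_j}[\mathrm df]\,g\Big)\Big\|_Z<\varepsilon$$ for every $T$-tagged $\delta$-fine system $Q=\{([\alpha_j,\beta_j],\xi_j):j=1,\dots,\nu(Q)\}$ in $[a,b]$.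
   Context: $[a,b]$ is a fixed compact interval in $\mathbb R$, $a<b$. A bilinear triple $\mathcal B=(X,Y,Z)$ consists of Banach spaces $X,Y,Z$ together with a bilinear map $B:X\times Y\to Z$, written $xy:=B(x,y)$, such that $\|xy\|_Z\le\beta\|x\|_X\|y\|_Y$ for some $\beta\in[0,\infty)$ (without loss of generality $\beta=1$). A function $h:[a,b]\to Z$ is regulated if it has a one-sided limit in $Z$ from the right at each point of $[a,b)$ and from the left at each point of $(a,b]$. A function $f:[a,b]\to X$ is simply-regulated ($f\in(\mathcal B)G([a,b],X)$) if for every $y\in Y$ the function $t\mapsto f(t)y\in Z$ is regulated on $[a,b]$. An elementary set is a finite union of mutually disjoint bounded intervals in $\mathbb R$. A gauge on a set $M\subset[a,b]$ is a function $\delta:M\to(0,\infty)$. For $a\le c<d\le b$, a tagged partition $P=\{([\alpha_{j-1},\alpha_j],\xi_j)\}_{j=1}^m$ of $[c,d]$ consists of $c=\alpha_0<\alpha_1<\dots<\alpha_m=d$ and $\xi_j\in[\alpha_{j-1},\alpha_j]$; it is $\delta$-fine if $[\alpha_{j-1},\alpha_j]\subset(\xi_j-\delta(\xi_j),\xi_j+\delta(\xi_j))$ for all $j$. For $f:[a,b]\to X$, $g:[a,b]\to Y$ put $S(\mathrm df,g,P)=\sum_{j=1}^m[f(\alpha_j)-f(\alpha_{j-1})]\,g(\xi_j)$. The Kurzweil-Stieltjes integral $\int_c^d[\mathrm df]\,g$ exists and equals $I\in Z$ if for every $\varepsilon>0$ there is a gauge $\delta$ on $[c,d]$ such that $\|S(\mathrm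 df,g,P)-I\|_Z<\varepsilon$ for every $\delta$-fine partition $P$ of $[c,d]$; also $\int_c^c[\mathrm df]\,g=0$. For an arbitrary set $M\subset[a,b]$ with characteristic function $\chi_M$, $\int_M[\mathrm df]\,g:=\int_a^b[\mathrm df]\,(g\chi_M)$ whenever the right-hand side exists. A sequence $\{g_n\}$ of functions $[a,b]\to Y$ is equi-integrable with respect to $f:[a,b]\to X$ on $[a,b]$ if $\int_a^b[\mathrm df]\,g_n$ exists for all $n\in\mathbb N$ and for every $\eta>0$ there is a gauge $\delta$ on $[a,b]$ such that $\big\|S(\mathrm df,g_n,P)-\int_a^b[\mathrm df]\,g_n\big\|_Z<\eta$ for every $\delta$-fine partition $P$ of $[a,b]$ and every $n\in\mathbb N$. A $T$-tagged $\delta$-fine system in $[a,b]$ is a finite set $Q=\{([\alpha_j,\beta_j],\xi_j):j=1,\dots,\nu(Q)\}$ with $a\le\alpha_1\le\xi_1\le\beta_1\le\alpha_2\le\xi_2\le\beta_2\le\dots\le\alpha_{\nu(Q)}\le\xi_{\nu(Q)}\le\beta_{\nu(Q)}\le b$, $\xi_j\in T$ and $[\alpha_j,\beta_j]\subset(\xi_j-\delta(\xi_j),\xi_j+\delta(\xi_j))$ for all $j$. *)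

(* Defs.v *)
From HB Require Import structures.
From mathcomp Require Import all_boot all_order all_algebra.
From mathcomp Require Import all_classical all_reals all_analysis.
Set Implicit Arguments.
Unset Strict Implicit.
Unset Printing Implicit Defensive.
Import Order.TTheory GRing.Theory Num.Theory.
Import numFieldNormedType.Exports.
Local Open Scope classical_set_scope.
Local Open Scope ring_scope.

(* Functions on [a, b] are total functions on R; every notion below only looks
   at their values on [a, b]. Likewise a gauge on M is a total function that is
   positive on M. *)

Section sets_and_gauges.
Context {R : realType}.

(* Intervals may be degenerate or empty. *)
Definition elementary_set (E : set R) : Prop :=
  exists (k : nat) (J : 'I_k -> set R),
    [/\ forall i, is_interval (J i) /\ bounded_set (J i),
        trivIset setT J & E = \bigcup_i J i].

Definition gauge (M : set R) (delta : R -> R) : Prop :=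
  forall t, M t -> 0 < delta t.

End sets_and_gauges.

(* The tagged interval ([alpha, beta], xi) is the triple ((alpha, beta), xi). *)
Notation tagged_itv R := (R * R * R)%type (only parsing).
Notation lend p := (p.1.1) (only parsing).
Notation rend p := (p.1.2) (only parsing).
Notation tag_of p := (p.2) (only parsing).

Section tagged_systems.
Context {R : realType}.
Implicit Types (P Q : seq (tagged_itv R)) (delta : R -> R) (T : set R).

Definition delta_fine delta P : Prop :=
  forall p, p \in P ->
    `[lend p, rend p] `<=`
    `](tag_of p - delta (tag_of p)), (tag_of p + delta (tag_of p))[.

(* The right endpoints are alpha_1 < ... < alpha_m = d (with c < alpha_1) and
   the left endpoints are c = alpha_0, ..., alpha_(m-1). *)
Definition tagged_partition (c d : R) P : Prop :=
  [/\ itv_partition c d [seq rend p | p <- P],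
      [seq lend p | p <- P] = belast c [seq rend p | p <- P] &
      forall p, p \in P -> lend p <= tag_of p <= rend p].

(* The chain a <= alpha_1 <= xi_1 <= beta_1 <= alpha_2 <= ... <= beta_nu <= b. *)
Definition tagged_system (a b : R) T delta Q : Prop :=
  [/\ sorted <=%R
        (a :: rcons (flatten [seq [:: lend p; tag_of p; rend p] | p <- Q]) b),
      forall p, p \in Q -> T (tag_of p) &
      delta_fine delta Q].

End tagged_systems.

Section kurzweil_stieltjes.
Context {R : realType} {X Y Z : completeNormedModType R}.
Variable B : {bilinear X -> Y -> Z}.
Implicit Types (f : R -> X) (g : R -> Y).

Definition bounded_bilinear : Prop :=
  exists2 beta : R, 0 <= beta & forall x y, `|B x y| <= beta * `|x| * `|y|.

Definition regulated (a b : R) (h : R -> Z) : Prop :=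
  (forall t, a <= t < b -> cvg (h s @[s --> t^'+])) /\
  (forall t, a < t <= b -> cvg (h s @[s --> t^'-])).

Definition simply_regulated (a b : R) f : Prop :=
  forall y : Y, regulated a b (fun t => B (f t) y).

Definition KS_sum f g (P : seq (tagged_itv R)) : Z :=
  \sum_(p <- P) B (f (rend p) - f (lend p)) (g (tag_of p)).

Definition is_KS_integral f g (c d : R) (I : Z) : Prop :=
  (c = d /\ I = 0) \/
  (c < d /\ forall eps : R, 0 < eps ->
     exists2 delta : R -> R, gauge `[c, d] delta &
       forall P, tagged_partition c d P -> delta_fine delta P ->
         `|KS_sum f g P - I| < eps).

Definition KS_integrable f g (c d : R) : Prop :=
  exists I : Z, is_KS_integral f g c d I.

(* Equal to 0 when the integral does not exist. *)
Definition KS_integral f g (c d : R) : Z := xget 0 (is_KS_integral f g c d).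

Definition equi_integrable f (gs : nat -> R -> Y) (a b : R) : Prop :=
  (forall n, KS_integrable f (gs n) a b) /\
  (forall eta : R, 0 < eta ->
     exists2 delta : R -> R, gauge `[a, b] delta &
       forall P, tagged_partition a b P -> delta_fine delta P ->
         forall n, `|KS_sum f (gs n) P - KS_integral f (gs n) a b| < eta).

Definition mul_char g (M : set R) : R -> Y := fun t => \1_M t *: g t.

Definition KS_integrable_on f g (a b : R) (M : set R) : Prop :=
  KS_integrable f (mul_char g M) a b.

Definition KS_integral_on f g (a b : R) (M : set R) : Z :=
  KS_integral f (mul_char g M) a b.

End kurzweil_stieltjes.

(* Main.v *)
Require Import Defs.
From HB Require Import structures.
From mathcomp Require Import all_boot all_order all_algebra.
From mathcomp Require Import all_classical all_reals all_analysis.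
From mathcomp Require Import lra.
Set Implicit Arguments.
Unset Strict Implicit.
Unset Printing Implicit Defensive.
Import Order.TTheory GRing.Theory Num.Theory.
Import numFieldNormedType.Exports.
Local Open Scope classical_set_scope.
Local Open Scope ring_scope.

(* The Kurzweil-Stieltjes integral is the limit of the sums along the filter of
   partitions generated by the delta-fine ones, which is proper by Cousin's
   lemma. Equi-integrability says that the sums of g chi_(S_n) converge to their
   integrals uniformly in n, while for a fixed partition they are eventually
   constant in n, equal to the sum of g chi_S; exchanging the two limits gives
   the integral over S as the limit of those over S_n, and (i) follows by
   linearity. The function g chi_T - g is then integrable and vanishes on T, so
   for T-tagged systems the Saks-Henstock lemma for it is exactly (ii). *)

(** * Fine chains and Cousin's lemma *)

Section fine_chains.
Context {R : realType}.
Implicit Types (P Q : seq (tagged_itv R)) (delta : R -> R) (c d e : R).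

(* Unlike a tagged_partition, a chain may contain degenerate intervals; this
   makes [c, c] an ordinary case and allows concatenation without side
   conditions. *)
Fixpoint fine_chain delta c d P : bool :=
  if P is p :: P' then
    [&& p.1.1 == c, c <= p.2 <= p.1.2, p.2 - delta p.2 < c,
        p.1.2 < p.2 + delta p.2 & fine_chain delta p.1.2 d P']
  else c == d.

Lemma fine_chain_cat delta c d e P Q :
  fine_chain delta c d P -> fine_chain delta d e Q ->
  fine_chain delta c e (P ++ Q).
Proof.
elim: P c => [c /= /eqP-> //|p P IH c /=].
by case/and5P=> -> -> -> -> /IH.
Qed.

Lemma fine_chain_le delta delta' c d P : (forall t, delta t <= delta' t) ->
  fine_chain delta c d P -> fine_chain delta' c d P.
Proof.
move=> dd'; elim: P c => [//|p P IH c /=].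
case/and5P=> -> -> h1 h2 /IH ->; have := dd' p.2.
by rewrite andbT /= => ?; apply/andP; split; lra.
Qed.

Lemma fine_chain_bounds delta c d P : fine_chain delta c d P -> c <= d.
Proof.
elim: P c => [c /= /eqP-> //|p P IH c /=].
by case/and5P=> _ /andP[h1 h2] _ _ /IH; apply: le_trans; apply: le_trans h2.
Qed.

Lemma fine_chain_tag delta c d P p :
  fine_chain delta c d P -> p \in P -> c <= p.2 <= d.
Proof.
elim: P c => [//|q P IH c /=].
case/and5P=> _ /andP[h1 h2] _ _ hP; rewrite inE => /predU1P[->|/(IH _ hP)].
  by rewrite h1 (le_trans h2)//; exact: fine_chain_bounds hP.
by move=> /andP[h3 ->]; rewrite andbT (le_trans h1)// (le_trans h2).
Qed.

(** All tags of a chain lie in [c, d]; once an endpoint passes d no continuation is possible and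
    both sides are false. This lets a gauge on [c, d] be extended arbitrarily to the whole line. *)
Lemma eq_fine_chain delta delta' c d P :
  (forall t, c <= t <= d -> delta t = delta' t) ->
  fine_chain delta c d P = fine_chain delta' c d P.
Proof.
elim: P c => [//|p P IH c /= dd'].
have [/andP[h1 h2]|] := boolP (c <= p.2 <= p.1.2); last by rewrite !andbF.
have [ped|dpe] := leP p.1.2 d.
  rewrite dd' ?h1 ?(le_trans h2)// IH// => t /andP[h3 h4].
  by apply: dd'; rewrite h4 (le_trans h1)// (le_trans h2).
have H D : fine_chain D p.1.2 d P = false.
  by apply/negP => /fine_chain_bounds; rewrite leNgt dpe.
by rewrite !H !andbF.
Qed.

(** Let s be the supremum of the points reachable from c. A chain ending close enough to s extends
    by one interval tagged s up to the minimum y of d and s + delta(s)/2. So y is reachable, hence y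
    <= s, which is only possible if y = d. *)
Lemma cousin delta c d : (forall t, 0 < delta t) -> c <= d ->
  exists P, fine_chain delta c d P.
Proof.
move=> dp cd.
pose A : set R := [set x | c <= x <= d /\ exists P, fine_chain delta c x P].
have Ac : A c by split; [rewrite lexx cd|exists [::] => /=].
have ubA : ubound A d by move=> x [/andP[]].
have hA : has_sup A by split; [exists c|exists d].
set s := sup A.
have As x : A x -> x <= s by move=> Ax; apply: ub_le_sup => //; exists d.
have [x Ax sx] := sup_adherent (dp s) hA.
have xs := As _ Ax; have cx : c <= x by case: Ax => /andP[].
have sd : s <= d by apply: ge_sup => //; exists c.
pose y := Num.min d (s + delta s / 2).
have dps := dp s.
have sy : s <= y by rewrite le_min sd /=; lra.
have yd : y <= d by rewrite ge_min lexx.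
have ysd : y < s + delta s by rewrite gt_min; apply/orP; right; lra.
have Ay : A y.
  split; first by rewrite yd andbT (le_trans cx)// (le_trans xs).
  case: Ax => _ [P hP]; exists (P ++ [:: ((x, y), s)]).
  by apply: fine_chain_cat hP _; rewrite /= !eqxx xs sy ysd/= andbT.
have ys := As _ Ay.
have -> : d = y; last by case: Ay.
apply/eqP; rewrite eq_le yd andbT.
by move: ys; rewrite {1}/y ge_min => /orP[ds|]; [rewrite (le_trans ds)|lra].
Qed.

(** * The filter of fine chains, and its relation to gauges and partitions *)

Definition KS_filter c d : set_system (seq (tagged_itv R)) :=
  [set A | exists2 delta : R -> R, (forall t, 0 < delta t) &
     forall P, fine_chain delta c d P -> A P].

#[global] Instance KS_filter_filter c d : Filter (KS_filter c d).
Proof.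
split.
- by exists (fun=> 1).
- move=> A A' [D Dp hA] [D' D'p hA'].
  exists (fun t => Num.min (D t) (D' t)) => [t|P hP]; first by rewrite lt_min Dp D'p.
  split; [apply: hA|apply: hA'];
    by apply: fine_chain_le hP => t; rewrite ge_min lexx ?orbT.
- by move=> A A' sA [D Dp hA]; exists D => // P /hA/sA.
Qed.

Lemma KS_filter_proper c d : c <= d -> ProperFilter (KS_filter c d).
Proof.
move=> cd; split; last exact: KS_filter_filter.
by case=> D Dp h; have [P /h] := cousin Dp cd.
Qed.

(** A single gauge serves on both pieces, because chains concatenate. The nested form allows P to be
    chosen first and Q afterwards. *)
Lemma KS_filter_cat c d e (A : set (seq (tagged_itv R))) :
  KS_filter c e A ->
  \forall P \near KS_filter c d, \forall Q \near KS_filter d e, A (P ++ Q).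
Proof.
move=> [D Dp hA]; exists D => // P hP; exists D => // Q hQ.
exact/hA/(fine_chain_cat hP hQ).
Qed.

Lemma tagged_partition_fine_chain delta c d P :
  tagged_partition c d P -> delta_fine delta P -> fine_chain delta c d P.
Proof.
elim: P c => [c [[_ h] _ _] _|p P IH c]; first exact: h.
case=> -[/= /andP[cp hp] hl] [pc hb] tagP fineP.
have := tagP p (mem_head _ _); rewrite pc => tp.
have := fineP p (mem_head _ _); rewrite pc => fp.
rewrite eqxx tp /=.
have := fp c; have := fp p.1.2; rewrite /= !in_itv/= !lexx (ltW cp) => /(_ isT)
  /andP[_ ->] /(_ isT)/andP[-> _] /=.
apply: IH.
  split=> // q qP; apply: tagP; by rewrite inE qP orbT.
by move=> q qP; apply: fineP; rewrite inE qP orbT.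
Qed.

(** A [tagged_partition] has strictly increasing endpoints. Discarding the degenerate intervals of a
    chain produces one, and the discarded terms of the sum are zero. *)
Definition nondegenerate P := [seq p <- P | p.1.1 < p.1.2].

Lemma nondegenerate_partition delta c d P : fine_chain delta c d P ->
  tagged_partition c d (nondegenerate P).
Proof.
elim: P c => [c /= /eqP->|p P IH c].
  by split => //; split => //=.
move=> /= /and5P[/eqP pc /andP[h1 h2] _ _ /IH].
have cp := le_trans h1 h2; rewrite pc.
case: ifPn => [lt_cp [[h3 h4] h5 h6]|]; last first.
  by rewrite -leNgt => pc'; have -> : p.1.2 = c by apply/le_anti; rewrite pc'.
split; first by split => //=; rewrite lt_cp.
  by rewrite /= pc h5.
move=> q; rewrite inE => /predU1P[->|]; last exact: h6.
by rewrite pc h1 h2.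
Qed.

Lemma nondegenerate_fine delta c d P : fine_chain delta c d P ->
  delta_fine delta (nondegenerate P).
Proof.
move=> h q; rewrite mem_filter => /andP[_].
elim: P c h => [//|p P IH c /=].
case/and5P=> /eqP pc _ h1 h2 hP; rewrite inE => /predU1P[->|]; last exact: IH hP.
move=> t /=; rewrite !in_itv/= pc => /andP[h3 h4].
by rewrite (lt_le_trans h1)//= (le_lt_trans h4).
Qed.

(** The gauge is extended by 1 outside [c, d]. The conclusion retains the chain property because it
    is what allows the sum over [nondegenerate P] to be replaced by the sum over P. *)
Lemma gauge_near_KS_filter delta c d (A : set (seq (tagged_itv R))) :
  gauge `[c, d] delta ->
  (forall P, tagged_partition c d P -> delta_fine delta P -> A P) ->
  \forall P \near KS_filter c d, fine_chain delta c d P /\ A (nondegenerate P).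
Proof.
move=> dp hA; pose D t := if c <= t <= d then delta t else 1.
exists D => [t|P].
  by rewrite /D; case: ifPn => // tcd; apply: dp; rewrite /= in_itv.
rewrite (@eq_fine_chain D delta) => [hP|t tcd]; last by rewrite /D tcd.
split=> //; apply: hA; first exact: nondegenerate_partition hP.
exact: nondegenerate_fine hP.
Qed.

Lemma tagged_system_bounds delta T c d Q p : tagged_system c d T delta Q ->
  p \in Q -> [/\ c <= p.1.1, p.1.1 <= p.1.2 & p.1.2 <= d].
Proof.
move=> [+ _ _]; rewrite /=; elim: Q c => [//|q Q IH] c /=.
move=> /and4P[cq qt tq hQ]; have qq := le_trans qt tq.
rewrite inE => /predU1P[->|/(IH _ hQ)[h1 h2 h3]].
  split=> //; move: hQ; rewrite (path_sortedE le_trans) => /andP[/allP/(_ d)].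
  by rewrite mem_rcons mem_head => /(_ isT).
by split=> //; rewrite (le_trans cq)// (le_trans qq).
Qed.

End fine_chains.

(** * The integral as a limit along the filter of chains *)

Section kurzweil_stieltjes_theory.
Context {R : realType} {X Y Z : completeNormedModType R}.
Variable B : {bilinear X -> Y -> Z}.
Implicit Types (f : R -> X) (g h : R -> Y) (a b c d e : R) (I : Z).

Lemma KS_sum_cat f g P Q : KS_sum B f g (P ++ Q) = KS_sum B f g P + KS_sum B f g Q.
Proof. exact: big_cat. Qed.

Lemma KS_sumB f g h P :
  KS_sum B f (fun t => g t - h t) P = KS_sum B f g P - KS_sum B f h P.
Proof. by rewrite /KS_sum -sumrB; apply: eq_bigr => p _; rewrite linearBr. Qed.

Lemma KS_sum_nondegenerate delta f g c d P : fine_chain delta c d P ->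
  KS_sum B f g (nondegenerate P) = KS_sum B f g P.
Proof.
rewrite /KS_sum big_filter big_mkcond.
elim: P c => [c _|p P IH c]; first by rewrite !big_nil.
rewrite !big_cons /= => /and5P[/eqP -> /andP[h1 h2] _ _ /IH ->].
congr (_ + _); case: ifPn => //; rewrite -leNgt => pc.
have -> : p.1.2 = c by apply/le_anti; rewrite pc (le_trans h1 h2).
by rewrite subrr linear0l.
Qed.

Lemma KS_sum_degenerate delta f g c P : fine_chain delta c c P ->
  KS_sum B f g P = 0.
Proof.
move=> hP; rewrite -(KS_sum_nondegenerate f g hP).
have [/itv_partitionxx + _ _] := nondegenerate_partition hP.
by case: nondegenerate => // _; exact: big_nil.
Qed.

Lemma is_KS_integral_cvg f g c d I :
  is_KS_integral B f g c d I -> KS_sum B f g @ KS_filter c d --> I.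
Proof.
case=> [[<- ->]|[ltcd hI]]; apply/cvgrPdistC_lt => eps e0.
  by exists (fun=> 1) => // P /KS_sum_degenerate ->; rewrite subrr normr0.
have [D Dp hD] := hI _ e0.
have := gauge_near_KS_filter Dp hD; apply: filterS => P [hP].
by rewrite (KS_sum_nondegenerate _ _ hP).
Qed.

Lemma is_KS_integralP f g c d I : c <= d ->
  is_KS_integral B f g c d I <-> KS_sum B f g @ KS_filter c d --> I.
Proof.
move=> cd; split; first exact: is_KS_integral_cvg.
move: cd; rewrite le_eqVlt => /predU1P[<- h|ltcd]; last first.
  move=> /cvgrPdistC_lt h; right; split=> // eps /h [D Dp hD].
  exists D => // P hP fP; apply: hD.
  exact: tagged_partition_fine_chain.
(* On a one-point interval 0 is also a limit of the sums, so uniqueness of limits forces I = 0. *)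
left; split=> //; have FF := KS_filter_proper (lexx c).
apply: (norm_cvg_unique h); apply: is_KS_integral_cvg; by left.
Qed.

Lemma KS_integrableP f g c d : c <= d ->
  KS_integrable B f g c d <->
  KS_sum B f g @ KS_filter c d --> KS_integral B f g c d.
Proof.
move=> cd; split=> [h|/(is_KS_integralP _ _ _ cd) h]; last by eexists; exact: h.
by apply/is_KS_integralP => //; exact: xgetPex.
Qed.

Lemma KS_integralE f g c d I : c <= d ->
  KS_sum B f g @ KS_filter c d --> I ->
  KS_integrable B f g c d /\ KS_integral B f g c d = I.
Proof.
move=> cd h; have hI : KS_integrable B f g c d by exists I; apply/is_KS_integralP.
split=> //; have FF := KS_filter_proper cd.
by apply: norm_cvg_unique h; apply/KS_integrableP.
Qed.

Lemma KS_integral_eq_on f g h c d : c <= d ->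
  (forall t, c <= t <= d -> g t = h t) -> KS_integrable B f h c d ->
  KS_integrable B f g c d /\ KS_integral B f g c d = KS_integral B f h c d.
Proof.
move=> cd gh /(KS_integrableP _ _ cd) hh; apply: KS_integralE => //.
apply: cvg_trans hh; apply: near_eq_cvg; exists (fun=> 1) => // P hP.
by apply: eq_big_seq => p /(fine_chain_tag hP)/gh->.
Qed.

Lemma KS_integralB f g h c d : c <= d ->
  KS_integrable B f g c d -> KS_integrable B f h c d ->
  KS_integrable B f (fun t => g t - h t) c d /\
  KS_integral B f (fun t => g t - h t) c d =
    KS_integral B f g c d - KS_integral B f h c d.
Proof.
move=> cd /(KS_integrableP _ _ cd) hg /(KS_integrableP _ _ cd) hh.
apply: KS_integralE => //.
have -> : KS_sum B f (fun t => g t - h t) = KS_sum B f g - KS_sum B f h.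
  by apply/funext => P; exact: KS_sumB.
exact: cvgB.
Qed.

(** * Integrability on subintervals and additivity *)

Lemma KS_integrable_sub f g a b c d : a <= c -> c <= d -> d <= b ->
  KS_integrable B f g a b -> KS_integrable B f g c d.
Proof.
move=> ac cd db /(KS_integrableP _ _ (le_trans ac (le_trans cd db))) h.
suff /cvg_ex[I hI] : cvg (KS_sum B f g @ KS_filter c d).
  by exists I; apply/is_KS_integralP.
have FF := KS_filter_proper cd.
apply/cauchy_cvgP/cauchy_ballP => eps e0.
have e20 : 0 < eps / 2 by rewrite divr_gt0.
move/cvgrPdistC_lt : h => /(_ _ e20) [D Dp hD].
have [P1 hP1] := cousin Dp ac; have [P2 hP2] := cousin Dp db.
pose G := [set P | fine_chain D c d P].
have FG : KS_filter c d G by exists D.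
exists (KS_sum B f g @` G, KS_sum B f g @` G).
  by split => /=; apply: filterS FG => P GP; exists P.
move=> [_ _] /= [[P hP <-] [Q hQ <-]].
(* Cauchy criterion: P and Q are completed to chains of [a, b] by the same P1 and P2, so the
   difference of their sums is that of two sums over [a, b], each within eps / 2 of the integral. *)
have := hD _ (fine_chain_cat hP1 (fine_chain_cat hQ hP2)).
have := hD _ (fine_chain_cat hP1 (fine_chain_cat hP hP2)).
rewrite !KS_sum_cat -ball_normE /ball_ /=.
move=> h1 h2; rewrite (splitr eps); apply: le_lt_trans (ltrD h1 h2).
apply: le_trans (ler_normB _ _); rewrite opprB addrA subrK.
rewrite opprD addrACA subrr add0r opprD addrACA subrr addr0.
exact: lexx.
Qed.

Lemma KS_integral_split f g c d e : c <= d -> d <= e ->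
  KS_integrable B f g c e ->
  KS_integral B f g c e = KS_integral B f g c d + KS_integral B f g d e.
Proof.
move=> cd de h; have ce := le_trans cd de.
have /(KS_integrableP _ _ cd)/cvgrPdistC_lt h1 :=
  KS_integrable_sub (lexx _) cd de h.
have /(KS_integrableP _ _ de)/cvgrPdistC_lt h2 :=
  KS_integrable_sub cd de (lexx _) h.
move/(KS_integrableP _ _ ce)/cvgrPdist_lt : h => h.
have Fcd := KS_filter_proper cd; have Fde := KS_filter_proper de.
apply/eqP; rewrite -subr_eq0 -normr_eq0; apply/eqP/le_anti.
rewrite normr_ge0 andbT; apply/ler_addgt0Pr => eps e0; rewrite add0r.
have e30 : 0 < eps / 3 by rewrite divr_gt0.
(* P is taken with its sum near the integral over [c, d] and such that P ++ Q is good for all fine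
   enough Q; then Q is taken among these with its sum near the integral over [d, e]. *)
have [P [hP /(filterI (h2 _ e30)) /filter_ex [Q [hQ hPQ]]]] :=
  filter_ex (filterI (h1 _ e30) (KS_filter_cat d (h _ e30))).
move: hP hQ hPQ; rewrite KS_sum_cat /=.
set S1 := KS_sum _ _ _ P; set S2 := KS_sum _ _ _ Q => hP hQ hPQ.
set I := KS_integral _ _ _ _ _; set I1 := KS_integral _ _ _ _ _.
set I2 := KS_integral _ _ _ _ _.
have -> : I - (I1 + I2) = (I - (S1 + S2)) + ((S1 - I1) + (S2 - I2)).
  by rewrite [X in _ = _ + X]addrACA -opprD addrA subrK.
apply: le_trans (ler_normD _ _) _.
apply: le_trans (lerD (lexx _) (ler_normD _ _)) _.
rewrite -/S1 -/I1 in hP hQ hPQ *; lra.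
Qed.

(** * Errors of single tagged intervals and the Saks-Henstock lemma *)

Definition defect f g (p : tagged_itv R) : Z :=
  B (f p.1.2 - f p.1.1) (g p.2) - KS_integral B f g p.1.1 p.1.2.

(* The chain P is Q together with fine chains filling its gaps, whose sums are
   as close as desired to the integrals over the gaps. *)
Lemma fill_gaps delta f g c b Q : (forall t, 0 < delta t) ->
  KS_integrable B f g c b ->
  path <=%R c
    (rcons (flatten [seq [:: lend p; tag_of p; rend p] | p <- Q]) b) ->
  delta_fine delta Q ->
  forall eps : R, 0 < eps -> exists2 P, fine_chain delta c b P &
    `|KS_sum B f g P - KS_integral B f g c b - \sum_(p <- Q) defect f g p|
      < eps.
Proof.
move=> dp; elim: Q c => [|q Q IH] c hg.
  rewrite /= andbT => cb _ eps e0.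
  have FF := KS_filter_proper cb.
  move/(KS_integrableP _ _ cb)/cvgrPdistC_lt : hg => /(_ _ e0) h.
  have hD : KS_filter c b [set P | fine_chain delta c b P] by exists delta.
  by have [P [hP ?]] := filter_ex (filterI hD h); exists P; rewrite // big_nil subr0.
rewrite /= => /and4P[cq qt tq hQ] fQ eps e0.
have qb : q.1.2 <= b.
  move: hQ; rewrite (path_sortedE le_trans) => /andP[/allP/(_ b)].
  by rewrite mem_rcons mem_head => /(_ isT).
have qq := le_trans qt tq; have cb := le_trans cq (le_trans qq qb).
have e20 : 0 < eps / 2 by rewrite divr_gt0.
have [||P2 hP2 h2] := IH q.1.2 _ hQ _ _ e20.
- exact: KS_integrable_sub (le_trans cq qq) qb (lexx _) hg.
- by move=> p pQ; apply: fQ; rewrite inE pQ orbT.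
have FF := KS_filter_proper cq.
have /(KS_integrableP _ _ cq)/cvgrPdistC_lt/(_ _ e20) h :=
  KS_integrable_sub (lexx _) cq (le_trans qq qb) hg.
have hD : KS_filter c q.1.1 [set P | fine_chain delta c q.1.1 P] by exists delta.
have [P1 [hP1 h1]] := filter_ex (filterI hD h).
exists (P1 ++ q :: P2).
  apply: fine_chain_cat hP1 _; rewrite /= eqxx qt tq hP2 /= andbT.
  have fq := fQ _ (mem_head _ _).
  have := fq q.1.1; have := fq q.1.2; rewrite /= !in_itv/= !lexx qq.
  by move=> /(_ isT)/andP[_ ->] /(_ isT)/andP[-> _].
rewrite KS_sum_cat {2}/KS_sum !big_cons -/(KS_sum B f g P2).
(* Once the integral is split at both ends of q, the contribution of q cancels against its own
   defect. What remains is the error of P1 on the gap before q plus the error of P2 after q, each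
   below eps / 2. *)
rewrite (KS_integral_split cq (le_trans qq qb) hg).
have hqb := KS_integrable_sub cq (le_trans qq qb) (lexx _) hg.
rewrite (KS_integral_split qq qb hqb) {1}/defect.
rewrite (splitr eps); apply: le_lt_trans (ltrD h1 h2).
apply: le_trans (ler_normD _ _).
rewrite le_eqVlt; apply/orP; left; apply/eqP; congr (`|_|).
set S1 := KS_sum _ _ _ P1; set S2 := KS_sum _ _ _ P2.
set s := \sum_(_ <- _) _.
set I1 := KS_integral _ _ _ _ _; set I2 := KS_integral _ _ _ _ _.
set I3 := KS_integral _ _ _ _ _. set x := B _ _.
have -> : S1 + (x + S2) - (I1 + (I2 + I3)) = (S1 - I1) + ((x - I2) + (S2 - I3)).
  by rewrite opprD addrACA; congr (_ + _); rewrite opprD addrACA.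
by rewrite -[LHS]addrA; congr (_ + _); rewrite opprD addrACA subrr add0r.
Qed.


(** After its gaps are filled, a system becomes a full chain whose total error is below eps / 2; the
    filled gaps account for less than another eps / 2 of it, so the remainder, the sum of defects
    over the system, is below eps. The gauge is independent of Q and T. *)
Lemma saks_henstock f g a b : KS_integrable B f g a b ->
  forall eps : R, 0 < eps -> exists2 delta : R -> R, (forall t, 0 < delta t) &
    forall Q T, tagged_system a b T delta Q ->
      `|\sum_(p <- Q) defect f g p| < eps.
Proof.
move=> hg eps e0; have [ab|ba] := leP a b; last first.
  (* For b < a there are no systems at all, since the chain of inequalities in one implies a <=
     b. *)
  exists (fun=> 1) => // Q T [/= + _ _]; rewrite (path_sortedE le_trans).
  move=> /andP[/allP/(_ b)]; rewrite mem_rcons mem_head => /(_ isT).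
  by rewrite leNgt ba.
have e20 : 0 < eps / 2 by rewrite divr_gt0.
have /(KS_integrableP _ _ ab)/cvgrPdistC_lt/(_ _ e20)[D Dp hD] := hg.
exists D => // Q T [hQ _ fQ].
have [P /hD/= h1 h2] := fill_gaps Dp hg hQ fQ e20.
set s := \sum_(_ <- _) _; set u := _ - _ in h1.
have -> : s = u - (u - s) by rewrite subKr.
by rewrite (splitr eps); apply: le_lt_trans (ltrD h1 h2); exact: ler_normB.
Qed.

(** * Limits of equi-integrable sequences *)

Lemma equi_integrable_lim f (gs : nat -> R -> Y) g a b : a <= b ->
  equi_integrable B f gs a b ->
  (forall t, \forall n \near \oo, gs n t = g t) ->
  KS_integrable B f g a b /\
  KS_integral B f (gs n) a b @[n --> \oo] --> KS_integral B f g a b.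
Proof.
move=> ab [hi heq] hlim; have FF := KS_filter_proper ab.
have [//||I [hI hI']] := @cvg_switch _ _ Z (KS_filter a b) _ \oo _
  (fun P n => KS_sum B f (gs n) P) (fun n => KS_integral B f (gs n) a b)
  (KS_sum B f g).
(* Uniform convergence in n along the filter: the gauge from equi-integrability is common to all
   n. *)
- apply/cvg_fct_entourageP => A; rewrite -entourage_ballE => -[eps /= e0 epsA].
  have [D Dp hD] := heq _ e0.
  have := gauge_near_KS_filter Dp hD; apply: filterS => P [hP hn] n.
  apply: epsA; rewrite -ball_normE /ball_ /= distrC.
  by rewrite -(KS_sum_nondegenerate _ _ hP).
(* A chain has finitely many tags, so pointwise eventual equality of [gs n] and g makes the sums
   eventually equal. *)
- move=> P; apply: cvg_near_cst; elim: P => [|p P IH].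
    by near=> n; rewrite /KS_sum !big_nil.
  near=> n; rewrite /KS_sum !big_cons; congr (_ + _); last by near: n.
  by congr (B _ _); near: n.
by have [? ->] := KS_integralE ab hI.
Unshelve. all: by end_near. Qed.

(** * Characteristic functions of differences and unions *)

Lemma mul_char_setD g (A C : set R) t : A `<=` C ->
  mul_char g (C `\` A) t = mul_char g C t - mul_char g A t.
Proof.
move=> AC; rewrite /mul_char indicE in_setD -scalerBl !indicE; congr (_ *: _).
have [tA|_] := boolP (t \in A); last by rewrite andbT subr0.
by rewrite andbF (mem_set (AC _ (set_mem tA))) subrr.
Qed.

Lemma mul_char_bigcup_near g (E : nat -> set R) t :
  \forall n \near \oo,
    mul_char g (\bigcup_(i in [set i | (i <= n)%N]) E i) t =
    mul_char g (\bigcup_i E i) t.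
Proof.
have [[i _ Eit]|nE] := pselect ((\bigcup_i E i) t).
  exists i => // n /= le_in; rewrite /mul_char !indicE !mem_set//; first by exists i.
  by exists i.
apply: nearW => n; rewrite /mul_char !indicE !memNset// => -[i _ Eit].
by apply: nE; exists i.
Qed.

Lemma KS_integral_onD f g a b (A C : set R) : a <= b -> A `<=` C ->
  KS_integrable_on B f g a b C -> KS_integrable_on B f g a b A ->
  KS_integrable_on B f g a b (C `\` A) /\
  KS_integral_on B f g a b (C `\` A) =
    KS_integral_on B f g a b C - KS_integral_on B f g a b A.
Proof.
move=> ab AC hC hA; rewrite /KS_integrable_on /KS_integral_on.
have -> : mul_char g (C `\` A) = (fun t => mul_char g C t - mul_char g A t).
  by apply/funext => t; exact: mul_char_setD.
exact: KS_integralB.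
Qed.

End kurzweil_stieltjes_theory.

(** * Exhaustion of S by finite unions, and the estimate for T-tagged systems *)

Theorem theorem5p5 (R : realType) (a b : R) (hab : a < b)
    (X Y Z : completeNormedModType R) (B : {bilinear X -> Y -> Z})
    (hB : bounded_bilinear B)
    (f : R -> X) (hf : simply_regulated B a b f) (g : R -> Y)
    (T S : set R) (hTab : T `<=` `[a, b]) (hT : closed T)
    (hS : S = `[a, b] `\` T)
    (E : nat -> set R) (hE : forall i, elementary_set (E i))
    (hEdisj : trivIset setT E) (hSE : S = \bigcup_i E i)
    (hg : KS_integrable_on B f g a b `[a, b])
    (hequi : equi_integrable B f
       (fun n => mul_char g (\bigcup_(i in [set i | (i <= n)%N]) E i)) a b) :
  ([/\ forall i, KS_integrable_on B f g a b (E i),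
       KS_integrable_on B f g a b S,
       KS_integrable_on B f g a b T,
       series (fun i => KS_integral_on B f g a b (E i)) @ \oo -->
         KS_integral_on B f g a b S &
       KS_integral_on B f g a b `[a, b] =
         KS_integral_on B f g a b T + KS_integral_on B f g a b S])
  /\
  (forall eps : R, 0 < eps ->
     exists2 delta : R -> R, gauge T delta &
       forall Q : seq (R * R * R), tagged_system a b T delta Q ->
         (forall p, p \in Q ->
            KS_integrable B f (mul_char g T) p.1.1 p.1.2 /\
            KS_integrable B f g p.1.1 p.1.2) /\
         `|\sum_(p <- Q) (KS_integral B f (mul_char g T) p.1.1 p.1.2
                          - KS_integral B f g p.1.1 p.1.2)| < eps).

Proof.
have le_ab := ltW hab.
(* Indices start at 0, so [Sn n] is the union of the n + 1 sets E_0, ..., E_n. *)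
pose Sn n := \bigcup_(i in [set i | (i <= n)%N]) E i.
have [hIS cvgS] : KS_integrable_on B f g a b S /\
    KS_integral_on B f g a b (Sn n) @[n --> \oo] --> KS_integral_on B f g a b S.
  apply: equi_integrable_lim hequi _ => // t; rewrite hSE.
  exact: mul_char_bigcup_near.
have Sn0 : Sn 0%N = E 0%N.
  apply/seteqP; split=> [t [i /=]|t Et]; last by exists 0%N.
  by rewrite leqn0 => /eqP->.
have SnS n : Sn n `<=` Sn n.+1 by move=> t [i /= le_in Et]; exists i => //=; exact: leqW.
(* Disjointness writes each later E_i as a difference of consecutive unions, so its integral is
   obtained by subtraction from the integrals that equi-integrability provides. *)
have ES n : E n.+1 = Sn n.+1 `\` Sn n.
  apply/seteqP; split=> t; last first.
    case=> -[i /=]; rewrite leq_eqVlt => /predU1P[->//|le_in] Et nS.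
    by case: nS; exists i.
  move=> Et; split; first by exists n.+1 => /=.
  case=> i /= le_in Eit; have := hEdisj i n.+1 I I.
  by move/(_ (ex_intro _ t (conj Eit Et))) => ei; rewrite ei ltnn in le_in.
have hSn n : KS_integrable_on B f g a b (Sn n) := hequi.1 n.
have hE_ n : KS_integrable_on B f g a b (E n.+1) /\ KS_integral_on B f g a b (E n.+1)
   = KS_integral_on B f g a b (Sn n.+1) - KS_integral_on B f g a b (Sn n).
  by rewrite ES; exact: KS_integral_onD.
have hT_ : T = `[a, b] `\` S.
  by rewrite hS setDD setIC; apply/esym/setIidPl.
have SI : S `<=` `[a, b] by rewrite hS; exact: subDsetl.
have [hIT IT] : KS_integrable_on B f g a b T /\ KS_integral_on B f g a b T =
    KS_integral_on B f g a b `[a, b] - KS_integral_on B f g a b S.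
  by rewrite hT_; exact: KS_integral_onD.
split.
  split => //.
  - by case=> [|n]; [rewrite -Sn0|case: (hE_ n)].
  (* The partial sum of [series] at n has n terms, so it is the one at n + 1 that telescopes to the
     integral over [Sn n]. *)
  - rewrite -cvg_shiftS.
    have -> // : [sequence series (fun i => KS_integral_on B f g a b (E i)) n.+1]_n
      = (fun n => KS_integral_on B f g a b (Sn n)).
    apply/funext => n /=; elim: n => [|n IH].
      by rewrite /series /= big_nat1 Sn0.
    by rewrite seriesSr IH (hE_ n).2 addrC subrK.
  - by rewrite IT subrK.
have [hIg _] : KS_integrable B f g a b /\ KS_integral B f g a b =
    KS_integral_on B f g a b `[a, b].
  apply: KS_integral_eq_on hg => // t tab.
  by rewrite /mul_char indicE mem_set ?scale1r//= in_itv.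
(* Part (ii) comes from the Saks-Henstock lemma for the integrand g chi_T - g. *)
have [hIh _] := KS_integralB le_ab hIT hIg.
move=> eps e0; have [D Dp hD] := saks_henstock hIh e0.
exists D => // Q hQ.
have Qb p : p \in Q -> [/\ a <= p.1.1, p.1.1 <= p.1.2 & p.1.2 <= b].
  exact: tagged_system_bounds hQ.
have hsub p : p \in Q -> KS_integrable B f (mul_char g T) p.1.1 p.1.2 /\
    KS_integrable B f g p.1.1 p.1.2.
  by move=> /Qb[h1 h2 h3]; split; [move: hIT|move: hIg]; exact: KS_integrable_sub.
(* At a tag in T the integrand g chi_T - g is zero, so the defect is minus the integral over the
   interval; hence the change of sign inside the norm. *)
split=> //; rewrite -normrN -sumrN.
rewrite (eq_big_seq (defect B f (fun t => mul_char g T t - g t))); first exact: hD hQ.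
move=> p pQ; have [h1 h2] := hsub _ pQ; have [_ h3 _] := Qb _ pQ.
rewrite /defect (KS_integralB h3 h1 h2).2.
have [_ /(_ _ pQ) tT _] := hQ.
by rewrite /mul_char indicE mem_set// scale1r subrr linear0r sub0r.
Qed.
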